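(* Let $f:\mathcal{X}\to\mathbb{R}$ be a monotone, normalized function with DR-submodularity ratio $\beta$, and let $\mathcal{P}=conv(E)\subseteq\mathbb{R}^n_+$ with $E$ a finite nonempty set. Suppose that $|f(\bm{x})-f(\bm{y})|\le L\|\bm{x}-\bm{y}\|$ for all $\bm{x},\bm{y}\in Frontier(\mathcal{P})$, and that $\|\bm{x}\|\le D$ for all $\bm{x}\in\mathcal{P}$. Let $\mathrm{OPT}=\max_{\bm{x}\in\mathcal{P}}f(\bm{x})$. Then for every positive integer $l$, the LDGM algorithm with $l$ steps outputs a point $\bm{x}\in\mathcal{P}$ with $$f(\bm{x})\ \ge\ (1-e^{-\beta})\cdot\mathrm{OPT}-\frac{(1-e^{-\beta})\,m\,D\,L}{l},$$ where $m=|\mathcal{E}|=|Frontier(E)|\le|E|$.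
   Context: Notation: for vectors, $\bm{x}\le\bm{y}$ means $x_i\le y_i$ for all $i$, and $\bm{x}<\bm{y}$ means $\bm{x}\le\bm{y}$ and $x_i<y_i$ for some $i$. $\|\cdot\|$ is the Euclidean norm, $\bm{\chi}_i$ the $i$-th unit vector, $\mathbb{R}_+$ the non-negative reals, $[n]=\{1,\dots,n\}$, $conv$ the convex hull. Functions: $\mathcal{X}=\prod_{i=1}^n\mathcal{X}_i$ with each $\mathcal{X}_i\subseteq\mathbb{R}_+$ compact. $f:\mathcal{X}\to\mathbb{R}$ is monotone if $\bm{x}\le\bm{y}$ implies $f(\bm{x})\le f(\bm{y})$, and normalized if $f(\bm{0})=0$. It is assumed that $\mathcal{X}$ contains every $\bm{z}$ with $\bm{0}\le\bm{z}\le\bm{p}$ for some $\bm{p}\in\mathcal{P}$ (so that $f$ is defined where needed). DR-submodularity ratio: $$\beta=\inf_{\bm{x}\le\bm{y},\,k\in\mathbb{R}_+,\,i\in[n]}\frac{f(\bm{x}+k\bm{\chi}_i)-f(\bm{x})}{f(\bm{y}+k\bm{\chi}_i)-f(\bm{y})},$$ where all four points lie in $\mathcal{X}$ and choices with zero denominator are disregarded (with $\beta=1$ if no choice remains). Frontier: for a set $S\subseteq\mathbb{R}^n_+$, $Frontier(S)=\{\bm{x}\in S:\ \nexists\,\bm{y}\in S,\ \bm{y}>\bm{x}\}$. LDGM algorithm (with parameter $l$): set $\mathcal{E}=\{\frac1l\bm{x}:\bm{x}\in Frontier(E)\}$ and $\bm{x}_0=\bm{0}$. For $t=0,1,\dots,l-1$: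 choose $\bm{e}^*\in\arg\max_{\bm{e}\in\mathcal{E}}\big(f(\bm{x}_t+\bm{e})-f(\bm{x}_t)\big)$ (ties broken arbitrarily) and set $\bm{x}_{t+1}=\bm{x}_t+\bm{e}^*$. Output $\bm{x}_l$. *)

(* Defs.v *)
From HB Require Import structures.
From mathcomp Require Export all_boot all_order all_algebra.
From mathcomp Require Export finmap.
From mathcomp Require Export all_classical all_reals all_analysis.

Set Implicit Arguments.
Unset Strict Implicit.
Unset Printing Implicit Defensive.

Export Order.TTheory GRing.Theory Num.Theory numFieldNormedType.Exports.

#[global] Open Scope classical_set_scope.
#[global] Open Scope ring_scope.

Section Vectors.
Context {R : realType} {n : nat}.
Implicit Types (x y : 'rV[R]_n) (S : set 'rV[R]_n).

Definition vle x y : Prop := forall i, x 0 i <= y 0 i.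

Definition vlt x y : Prop := vle x y /\ exists i, x 0 i < y 0 i.

(* The library norm on 'rV[R]_n is the sup norm; this is the Euclidean one. *)
Definition enorm x : R := Num.sqrt (\sum_i x 0 i ^+ 2).

Definition chi (i : 'I_n) : 'rV[R]_n := delta_mx 0 i.

Definition conv S : set 'rV[R]_n :=
  [set x | exists k (w : 'I_k -> R) (v : 'I_k -> 'rV[R]_n),
     [/\ forall j, 0 <= w j, \sum_j w j = 1, forall j, S (v j)
       & x = \sum_j w j *: v j]].

Definition Frontier S : set 'rV[R]_n :=
  [set x | S x /\ ~ exists2 y, S y & vlt x y].

Definition prodset (Xi : 'I_n -> set R) : set 'rV[R]_n :=
  [set x | forall i, Xi i (x 0 i)].

End Vectors.

Definition argmax {T : Type} {R : realType} (A : set T) (g : T -> R) : set T :=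
  [set a | A a /\ forall b, A b -> g b <= g a].

Section Functions.
Context {R : realType} {n : nat}.
(* Functions X -> R are given as total functions of which only the values on X
   are ever constrained. *)
Implicit Types (X : set 'rV[R]_n) (f : 'rV[R]_n -> R).

Definition monotone_on X f : Prop :=
  forall x y, X x -> X y -> vle x y -> f x <= f y.

Definition dr_ratios X f : set R :=
  [set r | exists (x y : 'rV[R]_n) (k : R) (i : 'I_n),
     let x' := x + k *: chi i in let y' := y + k *: chi i in
     [/\ X x, X x', X y & X y'] /\
     [/\ vle x y, 0 <= k, f y' - f y != 0
       & r = (f x' - f x) / (f y' - f y)]].

Definition dr_ratio X f : R :=
  if `[< dr_ratios X f !=set0 >] then inf (dr_ratios X f) else 1.

End Functions.

Section LDGM.
Context {R : realType} {n : nat}.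
Variables (E : set 'rV[R]_n) (f : 'rV[R]_n -> R) (l : nat).

Definition steps : set 'rV[R]_n := [set l%:R^-1 *: x | x in Frontier E].

Definition LDGM_run (xs : nat -> 'rV[R]_n) : Prop :=
  xs 0%N = 0 /\
  forall t, (t < l)%N ->
    exists2 e, argmax steps (fun e' => f (xs t + e') - f (xs t)) e
             & xs t.+1 = xs t + e.

(* Ties are broken arbitrarily, so there may be several outputs. *)
Definition LDGM_output : set 'rV[R]_n :=
  [set x | exists2 xs, LDGM_run xs & x = xs l].

End LDGM.

(* Main.v *)
Require Import Defs.
From mathcomp Require Import ring lra.

(* A maximizer [w *m V] of [f] may be taken on the Pareto frontier of the
   polytope, which is a union of faces; since [f] is Lipschitz there, rounding
   the weights [w] to multiples of [1/l] stays on the same face and costs at most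
   [m D L / l].  The rounded point [y] is a sum of [l] elements of [steps], so
   some step gains at least a fraction [1/l] of [beta (f y - f x_t)], and the gap
   [f y - f x_t] shrinks by the factor [1 - beta / l] at each iteration. *)

Set Implicit Arguments.
Unset Strict Implicit.
Unset Printing Implicit Defensive.

(** * Componentwise order and the Euclidean norm *)

Section Vectors.
Context {R : realType} {n : nat}.
Implicit Types (x y z : 'rV[R]_n).

Lemma vle_refl x : vle x x.
Proof. by move=> i. Qed.

Lemma vle_trans y x z : vle x y -> vle y z -> vle x z.
Proof. by move=> xy yz i; exact: le_trans (xy i) (yz i). Qed.

Lemma enorm_ge0 x : 0 <= enorm x.
Proof. exact: sqrtr_ge0. Qed.

Lemma enorm_sqr x : enorm x ^+ 2 = \sum_i x 0 i ^+ 2.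
Proof. by rewrite sqr_sqrtr // sumr_ge0 // => i _; exact: sqr_ge0. Qed.

Lemma enorm0 : enorm (0 : 'rV[R]_n) = 0.
Proof. by rewrite /enorm big1 ?sqrtr0 // => i _; rewrite mxE expr0n. Qed.

Lemma enormZ (a : R) x : enorm (a *: x) = `|a| * enorm x.
Proof.
rewrite /enorm -sqrtr_sqr -sqrtrM ?sqr_ge0 // mulr_sumr.
by congr Num.sqrt; apply: eq_bigr => i _; rewrite mxE exprMn.
Qed.

Lemma enorm_eq0 x i : enorm x = 0 -> x 0 i = 0.
Proof.
move=> x0; have /eqP := enorm_sqr x; rewrite x0 expr0n /= eq_sym.
rewrite psumr_eq0 => [/allP/(_ i)|j _]; last exact: sqr_ge0.
by rewrite mem_index_enum sqrf_eq0 => /(_ isT)/eqP.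
Qed.

(** Cauchy-Schwarz: expand the nonnegative sum of squares of [enorm y * x - enorm x * y]. Zero norms
    are split off first so that the product of the norms can be cancelled. *)
Lemma dot_le_enorm x y : \sum_i x 0 i * y 0 i <= enorm x * enorm y.
Proof.
have [x0|x0] := eqVneq (enorm x) 0.
  by rewrite x0 mul0r big1 // => i _; rewrite (enorm_eq0 _ x0) mul0r.
have [y0|y0] := eqVneq (enorm y) 0.
  by rewrite y0 mulr0 big1 // => i _; rewrite (enorm_eq0 _ y0) mulr0.
have xy_gt0 : 0 < enorm x * enorm y by rewrite mulr_gt0 // lt0r ?x0 ?y0 enorm_ge0.
have : 0 <= \sum_i (enorm y * x 0 i - enorm x * y 0 i) ^+ 2.
  by apply: sumr_ge0 => i _; exact: sqr_ge0.
have -> : \sum_i (enorm y * x 0 i - enorm x * y 0 i) ^+ 2 =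
    enorm y ^+ 2 * (\sum_i x 0 i ^+ 2) + enorm x ^+ 2 * (\sum_i y 0 i ^+ 2)
    - 2 * (enorm x * enorm y) * \sum_i x 0 i * y 0 i.
  rewrite !mulr_sumr -big_split /= -sumrB; apply: eq_bigr => i _; ring.
rewrite -!enorm_sqr => h; rewrite -(ler_pM2l xy_gt0); nra.
Qed.

Lemma enorm_triangle x y : enorm (x + y) <= enorm x + enorm y.
Proof.
rewrite -(@ler_pXn2r _ 2) ?nnegrE ?addr_ge0 ?enorm_ge0 //.
rewrite enorm_sqr.
have -> : \sum_i (x + y) 0 i ^+ 2 =
    \sum_i x 0 i ^+ 2 + 2 * (\sum_i x 0 i * y 0 i) + \sum_i y 0 i ^+ 2.
  rewrite mulr_sumr -!big_split /=; apply: eq_bigr => i _; rewrite mxE; ring.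
by rewrite -!enorm_sqr; have := dot_le_enorm x y; nra.
Qed.

Lemma enorm_sum (I : Type) (r : seq I) (F : I -> 'rV[R]_n) :
  enorm (\sum_(i <- r) F i) <= \sum_(i <- r) enorm (F i).
Proof.
elim/big_rec2: _ => [|i s x _ le_xs]; first by rewrite enorm0.
by rewrite (le_trans (enorm_triangle _ _)) // lerD2l.
Qed.

End Vectors.

(** * The DR-submodularity ratio, from single coordinates to vectors *)

Section DRRatio.
Context {R : realType} {n : nat}.
Implicit Types (X : set 'rV[R]_n) (f : 'rV[R]_n -> R) (x y d : 'rV[R]_n).

Lemma vle_addr x d : vle 0 d -> vle x (x + d).
Proof. by move=> d0 i; rewrite mxE lerDl; have := d0 i; rewrite mxE. Qed.

Lemma chi_ge0 (k : R) (i : 'I_n) : 0 <= k -> vle 0 (k *: chi i).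
Proof. by move=> k0 j; rewrite !mxE mulr_ge0 ?ler0n. Qed.

Lemma dr_ratios_ge0 X f r : monotone_on X f -> dr_ratios X f r -> 0 <= r.
Proof.
move=> fM [x [y [k [i /= [[Xx Xx' Xy Xy'] [_ k0 _ ->]]]]]].
by rewrite divr_ge0 // subr_ge0; apply: fM => //; exact: vle_addr (chi_ge0 _ k0).
Qed.

Lemma dr_ratio_ge0 X f : monotone_on X f -> 0 <= dr_ratio X f.
Proof.
move=> fM; rewrite /dr_ratio; case: asboolP => // ne.
by apply: lb_le_inf => // r /(dr_ratios_ge0 fM).
Qed.

Lemma dr_ratio_le X f r :
  monotone_on X f -> dr_ratios X f r -> dr_ratio X f <= r.
Proof.
move=> fM Xr; rewrite /dr_ratio; case: asboolP => [_|]; last by case; exists r.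
by apply: ge_inf => //; exists 0 => q /(dr_ratios_ge0 fM).
Qed.

(** Any admissible choice can be replaced by one with [x = y], whose ratio is 1. *)
Lemma dr_ratio_le1 X f : monotone_on X f -> dr_ratio X f <= 1.
Proof.
move=> fM; have [[r Xr]|e] := pselect (dr_ratios X f !=set0); last first.
  by rewrite /dr_ratio; case: asboolP.
apply: dr_ratio_le => //; case: Xr => x [y [k [i /= [[_ _ Xy Xy'] [_ k0 ne _]]]]].
by exists y, y, k, i; split=> //; split=> //; rewrite divff.
Qed.

Lemma dr_ratio_coord X f x y k i : monotone_on X f ->
  X x -> X (x + k *: chi i) -> X y -> X (y + k *: chi i) ->
  vle x y -> 0 <= k ->
  dr_ratio X f * (f (y + k *: chi i) - f y) <= f (x + k *: chi i) - f x.
Proof.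
move=> fM Xx Xx' Xy Xy' xy k0.
have fx_ge0 : 0 <= f (x + k *: chi i) - f x.
  by rewrite subr_ge0; apply: fM => //; exact: vle_addr (chi_ge0 _ k0).
have fy_ge0 : 0 <= f (y + k *: chi i) - f y.
  by rewrite subr_ge0; apply: fM => //; exact: vle_addr (chi_ge0 _ k0).
have [->|ne] := eqVneq (f (y + k *: chi i) - f y) 0; first by rewrite mulr0.
rewrite -ler_pdivlMr ?lt0r ?ne //.
by apply: dr_ratio_le => //; exists x, y, k, i.
Qed.

(** The increment [d] is added one coordinate at a time to both points; [u m] holds its first [m]
    coordinates, and the coordinate inequalities telescope. The box condition keeps every
    intermediate point in the domain. *)
Lemma dr_ratio_vector X f x y d : monotone_on X f ->
  (forall z, vle 0 z -> vle z (y + d) -> X z) ->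
  vle 0 x -> vle x y -> vle 0 d ->
  dr_ratio X f * (f (y + d) - f y) <= f (x + d) - f x.
Proof.
move=> fM XP x0 xy d0.
pose u m : 'rV[R]_n := \row_i (if (i < m)%N then d 0 i else 0).
have d0i i : 0 <= d 0 i by have := d0 i; rewrite mxE.
have x0i i : 0 <= x 0 i by have := x0 i; rewrite mxE.
have u_ge0 m i : 0 <= u m 0 i by rewrite mxE; case: ifP.
have u_le m i : u m 0 i <= d 0 i by rewrite mxE; case: ifP.
have Xxu m : X (x + u m).
  apply: XP => i; rewrite !mxE.
    by have := u_ge0 m i; have := x0i i; rewrite mxE; lra.
  by have := u_le m i; have := xy i; rewrite mxE; lra.
have Xyu m : X (y + u m).
  apply: XP => i; rewrite !mxE.
    by have := u_ge0 m i; have := x0i i; have := xy i; rewrite mxE; lra.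
  by have := u_le m i; rewrite mxE; lra.
suff H m : (m <= n)%N ->
    dr_ratio X f * (f (y + u m) - f y) <= f (x + u m) - f x.
  have := H n (leqnn n); suff -> : u n = d by [].
  by apply/rowP => i; rewrite mxE ltn_ord.
elim: m => [_|m IHm mn].
  have -> : u 0%N = 0 by apply/rowP => i; rewrite !mxE.
  by rewrite !addr0 !subrr mulr0.
pose i := Ordinal mn.
have uS : u m.+1 = u m + d 0 i *: chi i.
  apply/rowP => j; rewrite !mxE eqxx /= ltnS leq_eqVlt -(inj_eq val_inj j i) /=.
  case: eqP => [jm|_] /=; last by rewrite mulr0 addr0.
  have -> : j = i by exact: val_inj.
  by rewrite ltnn mulr1 add0r.
have := IHm (ltnW mn).
have := @dr_ratio_coord X f (x + u m) (y + u m) (d 0 i) i fM (Xxu m).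
rewrite -!addrA -uS => /(_ (Xxu _) (Xyu _) (Xyu _)).
have le_u : vle (x + u m) (y + u m).
  by move=> j; rewrite [leLHS]mxE [leRHS]mxE lerD2r; exact: xy.
move=> /(_ le_u (d0i i)); lra.
Qed.

(* [sum_(e <- es) e] is split greedily: every increment below [e] raises f at
   [x] by at most [M], and the DR ratio moves it to the top of the chain. *)
Lemma dr_ratio_cover X f x d (es : seq 'rV[R]_n) (M : R) : monotone_on X f ->
  (forall z, vle 0 z -> vle z (x + d) -> X z) ->
  vle 0 x -> vle 0 d -> vle d (\sum_(e <- es) e) ->
  (forall e, e \in es -> [/\ vle 0 e, X (x + e) & f (x + e) - f x <= M]) ->
  dr_ratio X f * (f (x + d) - f x) <= (size es)%:R * M.
Proof.
move=> fM + x0; have x0i i : 0 <= x 0 i by have := x0 i; rewrite mxE.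
elim: es d => [|e es IHes] d XP d0 dle esP.
  have -> : d = 0.
    by apply/rowP => i; apply/le_anti; rewrite d0 andbT; have := dle i; rewrite big_nil.
  by rewrite addr0 subrr mulr0 mul0r.
have d0i i : 0 <= d 0 i by have := d0 i; rewrite mxE.
have [e0 Xe eM] := esP e (mem_head _ _).
pose s := \sum_(e <- es) e : 'rV[R]_n.
have s0 i : 0 <= s 0 i.
  rewrite /s summxE big_seq sumr_ge0 // => e' e's.
  have [e'0 _ _] := esP e' (mem_behead (s := e :: es) e's).
  by have := e'0 i; rewrite mxE.
(* [d'] is the share of [d] that the tail of the list can cover; what remains, [d - d'], is at most
   [e]. *)
pose d' : 'rV[R]_n := \row_i Num.min (d 0 i) (s 0 i).
have d'0 : vle 0 d' by move=> i; rewrite !mxE le_min d0i s0.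
have d'd : vle d' d by move=> i; rewrite mxE ge_min lexx.
have := IHes d' _ d'0 _ _.
have XP' z : vle 0 z -> vle z (x + d') -> X z.
  move=> z0 zd'; apply: XP => // i; apply: le_trans (zd' i) _.
  by rewrite [leLHS]mxE [leRHS]mxE lerD2l.
move=> /(_ XP').
have d's : vle d' s by move=> i; rewrite mxE ge_min lexx orbT.
move=> /(_ d's (fun e' e's => esP e' (mem_behead (s := e :: es) e's))) IH.
have ddle : vle (d - d') e.
  move=> i; rewrite !mxE; have := dle i; rewrite big_cons -/s mxE.
  by have := d0i i; have := e0 i; rewrite mxE; case: (leP (d 0 i) (s 0 i)); lra.
have dd0 : vle 0 (d - d').
  by move=> i; rewrite [leRHS]mxE [in leRHS]mxE mxE subr_ge0; exact: d'd.
(* The last increment is moved from [x + d'] down to [x], where monotonicity bounds its gain by that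
   of [e], hence by [M]. *)
have := @dr_ratio_vector X f x (x + d') (d - d') fM _ x0 (vle_addr _ d'0) dd0.
have -> : x + d' + (d - d') = x + d by apply/rowP => i; rewrite !mxE; ring.
move=> /(_ XP).
have Xdd : X (x + (d - d')).
  apply: XP => i; have := d'0 i; have := dd0 i; have := d0i i; have := x0i i;
    rewrite !mxE; lra.
have : f (x + (d - d')) <= f (x + e).
  by apply: fM => // i; rewrite [leLHS]mxE [leRHS]mxE lerD2l.
rewrite /= -natr1; lra.
Qed.

End DRRatio.

(** * Weight vectors and their compactness *)

Lemma continuous_sumr {R : realType} {T : topologicalType} (I : Type) (r : seq I)
    (g : I -> T -> R) :
  (forall i, continuous (g i)) -> continuous (fun x => \sum_(i <- r) g i x).
Proof.
by move=> gc; apply: continuous_big => [|i _]; [exact: add_continuous|exact: gc].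
Qed.

(** The total mass [c] is a parameter: it is 1 for convex combinations, [t / l] after [t] greedy
    steps, and [l] in the integer rounding. *)
Definition weights {R : realType} k (c : R) : set 'rV[R]_k :=
  [set w | (forall j, 0 <= w 0 j) /\ \sum_j w 0 j = c].

Arguments weights {R} k c _.

(** A finite set stored as a matrix, so that its convex combinations are the products [w *m V]. *)
Definition rows {R : realType} {k n} (V : 'M[R]_(k, n)) : set 'rV[R]_n :=
  [set row j V | j in setT].

Section Weights.
Context {R : realType} {k : nat}.
Implicit Types (w u : 'rV[R]_k) (c : R).

Lemma weights_le w c j : weights k c w -> w 0 j <= c.
Proof.
by case=> w0 <-; rewrite (bigD1 j) //= lerDl sumr_ge0.
Qed.

Lemma weights0 : weights k (0 : R) 0.
Proof. by split=> [j|]; [rewrite mxE|rewrite big1 // => j _; rewrite mxE]. Qed.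

Lemma weights_delta j : weights k (1 : R) (delta_mx 0 j).
Proof.
split=> [i|]; first by rewrite mxE ler0n.
by rewrite (bigD1 j) //= mxE !eqxx big1 ?addr0 // => i /negPf ij; rewrite mxE ij andbF.
Qed.

Lemma weightsD w u c c' : weights k c w -> weights k c' u -> weights k (c + c') (w + u).
Proof.
move=> [w0 wc] [u0 uc]; split=> [j|]; first by rewrite mxE addr_ge0.
by rewrite -wc -uc -big_split; apply: eq_bigr => j _; rewrite mxE.
Qed.

Lemma weightsZ w c a : 0 <= a -> weights k c w -> weights k (a * c) (a *: w).
Proof.
move=> a0 [w0 wc]; split=> [j|]; first by rewrite mxE mulr_ge0.
by rewrite -wc mulr_sumr; apply: eq_bigr => j _; rewrite mxE.
Qed.

Lemma weights_compact c : compact (weights k c).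
Proof.
have -> : weights k c =
    [set w : 'rV[R]_k | forall j, `[0, c]%classic (w 0 j)] `&`
    (fun w : 'rV[R]_k => \sum_j w 0 j) @^-1` [set c].
  apply/seteqP; split=> w.
    move=> wP; split; last exact: wP.2.
    by move=> j; rewrite /= in_itv /= wP.1 (weights_le _ wP).
  by case=> w01 wc; split=> // j; have := w01 j; rewrite /= in_itv /= => /andP[].
apply: compact_closedI.
  exact: (@rV_compact R k (fun=> `[0, c]%classic) (fun=> @segment_compact R 0 c)).
apply: (@preimage_closed _ R (fun w : 'rV[R]_k => \sum_j w 0 j) [set c]);
  last exact: closed_eq.
move=> w _; move: w; apply: continuous_sumr => j; exact: coord_continuous.
Qed.

End Weights.

(** * Faces, Pareto frontier and maximizers of a polytope *)

Section Polytope.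
Context {R : realType} {k n : nat}.
Variable V : 'M[R]_(k, n).
Implicit Types (w u : 'rV[R]_k) (x y : 'rV[R]_n).

Lemma mul_rowE w : w *m V = \sum_j w 0 j *: row j V.
Proof. by rewrite mulmx_sum_row. Qed.

Lemma conv_rows : conv (rows V) = [set w *m V | w in weights k 1].
Proof.
apply/seteqP; split=> x.
  move=> [m [w [v [w0 w1 vE ->]]]].
  have /choice[s sE] j : exists i, row i V = v j by have [i _ <-] := vE j; exists i.
  exists (\sum_j w j *: delta_mx 0 (s j)).
    split=> [i|].
      by rewrite summxE sumr_ge0 // => j _; rewrite mxE mulr_ge0 // mxE ler0n.
    under eq_bigr do rewrite summxE.
    rewrite exchange_big /= -w1; apply: eq_bigr => j _.
    under eq_bigr do rewrite mxE.
    by rewrite -mulr_sumr (weights_delta (s j)).2 mulr1.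
  rewrite mulmx_suml; apply: eq_bigr => j _.
  by rewrite -scalemxAl -rowE sE.
move=> [w [w0 w1] <-]; exists k, (fun j => w 0 j), (fun j => row j V).
by split=> //; [move=> j; exists j|exact: mul_rowE].
Qed.

Lemma conv_mul w : weights k 1 w -> conv (rows V) (w *m V).
Proof. by rewrite conv_rows => ww; exists w. Qed.

Lemma conv_row j : conv (rows V) (row j V).
Proof. by rewrite rowE; exact/conv_mul/weights_delta. Qed.

Lemma coord_mul_continuous i : continuous (fun w : 'rV[R]_k => (w *m V) 0 i).
Proof.
under eq_fun do rewrite mxE.
apply: continuous_sumr => j w.
by apply: (@cvgMr_tmp _ _ (nbhs w)); exact: coord_continuous.
Qed.

(* Support of [w'] inside that of [w] means that [w' *m V] lies on the smallest
   face through [w *m V]: an improvement available at the former is available,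
   after scaling, at the latter. *)
Lemma Frontier_face w w' : weights k 1 w -> weights k 1 w' ->
  (forall j, w 0 j = 0 -> w' 0 j = 0) ->
  Frontier (conv (rows V)) (w *m V) -> Frontier (conv (rows V)) (w' *m V).
Proof.
move=> ww ww' sub [_ wF]; split; first exact: conv_mul.
move=> [y]; rewrite {1}conv_rows => -[u uw <-{y}] [wu [i wui]]; apply: wF.
(* The least positive weight of [w], capped at 1; since the weights of [w'] are at most 1 and
   supported in [w], subtracting [e * w'] from [w] keeps all weights nonnegative. *)
pose e : R := \big[Num.min/1]_(j | 0 < w 0 j) w 0 j.
have e0 : 0 < e by exact: lt_bigmin.
have ew j : e * w' 0 j <= w 0 j.
  have [wj0|wj0] := eqVneq (w 0 j) 0; first by rewrite sub // wj0 mulr0.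
  have wj : 0 < w 0 j by rewrite lt0r wj0 ww.1.
  have ej : e <= w 0 j by exact: bigmin_le_cond.
  have := weights_le j ww'; have := ww'.1 j; nra.
exists ((w + e *: (u - w')) *m V).
  apply: conv_mul; split=> [j|].
    by rewrite !mxE; have := ew j; have := uw.1 j; nra.
  under eq_bigr do rewrite !mxE mulrBr.
  by rewrite big_split /= sumrB -!mulr_sumr ww.2 uw.2 ww'.2 subrr addr0.
have E j : ((w + e *: (u - w')) *m V) 0 j =
    (w *m V) 0 j + e * ((u *m V) 0 j - (w' *m V) 0 j).
  by rewrite mulmxDl -scalemxAl mulmxBl !mxE.
split=> [j|]; first by rewrite E lerDl mulr_ge0 ?subr_ge0 // ltW.
by exists i; rewrite E ltrDl mulr_gt0 ?subr_gt0.
Qed.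

(** Maximize the coordinate sum over the compact set of weights whose points lie above [x]; a point
    dominating the maximizer would have a larger sum. *)
Lemma Frontier_dominates x : conv (rows V) x ->
  exists2 y, Frontier (conv (rows V)) y & vle x y.
Proof.
rewrite {1}conv_rows => -[w ww <-{x}].
pose A := weights k 1 `&`
  \bigcap_(i in setT) [set u : 'rV[R]_k | (w *m V) 0 i <= (u *m V) 0 i].
have cA : compact A.
  apply: compact_closedI; first exact: weights_compact.
  apply: closed_bigI => i _.
  apply: (@preimage_closed _ R (fun u : 'rV[R]_k => (u *m V) 0 i)
    [set t | (w *m V) 0 i <= t]); last exact: closed_ge.
  by move=> u _; exact: coord_mul_continuous.
have A0 : A !=set0 by exists w; split=> // i _ /=.
have cs : {within A, continuous (fun u : 'rV[R]_k => \sum_i (u *m V) 0 i)}.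
  apply: continuous_subspaceT; apply: continuous_sumr => i.
  exact: coord_mul_continuous.
have [u /set_mem [uw wu] umax] := EVT_max_rV A0 cA cs.
exists (u *m V); last by move=> i; exact: wu.
split; first exact: conv_mul.
move=> [y]; rewrite {1}conv_rows => -[z zw <-{y}] [uz [i uzi]].
have : A z by split=> // j _; apply: le_trans (uz j); exact: wu.
move=> /mem_set/umax; apply/negP; rewrite -ltNge.
rewrite (bigD1 i) //= [ltRHS](bigD1 i) //=.
by apply: ltr_leD => //; apply: ler_sum => j _; exact: uz.
Qed.

Variables (f : 'rV[R]_n -> R) (L D : R).
Hypothesis L0 : 0 <= L.
Hypothesis fL : forall x y, Frontier (conv (rows V)) x -> Frontier (conv (rows V)) y ->
  `|f x - f y| <= L * enorm (x - y).
Hypothesis VD : forall x, conv (rows V) x -> enorm x <= D.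

(** The difference of the points is a combination of rows, each of norm at most [D], so the
    Lipschitz bound passes to the l1 distance of the weights. *)
Lemma lipschitz_weights w u :
  Frontier (conv (rows V)) (w *m V) -> Frontier (conv (rows V)) (u *m V) ->
  `|f (w *m V) - f (u *m V)| <= L * D * \sum_j `|w 0 j - u 0 j|.
Proof.
move=> wF uF; apply: le_trans (fL wF uF) _; rewrite -mulrA ler_wpM2l //.
rewrite -mulmxBl mul_rowE; apply: le_trans (enorm_sum _ _) _.
rewrite mulr_sumr; apply: ler_sum => j _.
rewrite enormZ mulrC !mxE; apply: ler_wpM2r => //; exact/VD/conv_row.
Qed.

(** Continuity of [f] is available on the frontier only, so the extreme value theorem is applied on
    each of the finitely many faces inside the frontier, and the best face is taken. By monotonicity
    and [Frontier_dominates] no point of the polytope does better. *)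
Lemma exists_argmax_conv w0 : weights k 1 w0 ->
  (forall x y, conv (rows V) x -> conv (rows V) y -> vle x y -> f x <= f y) ->
  exists2 w, weights k 1 w &
    Frontier (conv (rows V)) (w *m V) /\ argmax (conv (rows V)) f (w *m V).
Proof.
move=> ww0 fM.
pose P := conv (rows V).
(* [K S] consists of the weights supported in [S]; [good S] below says that it is nonempty and maps
   into the frontier. *)
pose K (S : {set 'I_k}) : set 'rV[R]_k := weights k 1 `&` \bigcap_(j in setT)
  [set w : 'rV[R]_k | j \notin S -> w 0 j = 0].
have cK S : compact (K S).
  apply: compact_closedI; first exact: weights_compact.
  apply: closed_bigI => j _; have [jS|jS] := boolP (j \in S).
    rewrite [X in closed X](_ : _ = setT); first exact: closedT.
    by apply/seteqP; split.
  rewrite [X in closed X](_ : _ = (fun w : 'rV[R]_k => w 0 j) @^-1` [set 0]).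
    apply: (@preimage_closed _ R (fun w : 'rV[R]_k => w 0 j) [set 0]);
      last exact: closed_eq.
    by move=> w _; exact: coord_continuous.
  by apply/seteqP; split=> w /=; [exact|].
pose good (S : {set 'I_k}) :=
  `[< K S !=set0 /\ forall w, K S w -> Frontier P (w *m V) >].
have maxK S : good S -> exists2 w, K S w & forall u, K S u -> f (u *m V) <= f (w *m V).
  move=> /asboolP[KS0 KSF].
  have cf : {within K S, continuous (fun w : 'rV[R]_k => f (w *m V))}.
    apply/subspace_continuousP => w Kw; apply/cvgrPdist_le => e e0.
    have D0 : 0 <= D by apply: le_trans (VD (conv_mul ww0)); exact: enorm_ge0.
    have /(_ w) : continuous (fun u : 'rV[R]_k => L * D * \sum_j `|w 0 j - u 0 j|).
      move=> u; apply: (@cvgMl_tmp _ _ (nbhs u)); move: u; apply: continuous_sumr => j u.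
      apply: (@cvg_norm _ _ _ (nbhs u)); apply: (@cvgB _ _ _ (nbhs u)).
        exact: cvg_cst.
      exact: coord_continuous.
    rewrite /continuous_at big1 ?mulr0; last by move=> j _; rewrite subrr normr0.
    move=> /cvgr0_norm_le/(_ e e0) He; near=> u.
    have Ku : K S u by near: u; exact: withinT.
    apply: le_trans (lipschitz_weights (KSF _ Kw) (KSF _ Ku)) _.
    apply: le_trans (ler_norm _) _.
    near: u; exact: cvg_within.
  have [w /set_mem Kw wmax] := EVT_max_rV KS0 (cK S) cf.
  by exists w => // u Ku; apply: wmax; exact: mem_set.
(* By [Frontier_face], one frontier point makes its whole support good. *)
have supp w : weights k 1 w -> Frontier P (w *m V) ->
    K [set j | w 0 j != 0]%SET w /\ good [set j | w 0 j != 0]%SET.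
  move=> ww wF; have Kw : K [set j | w 0 j != 0]%SET w.
    by split=> // j _; rewrite /= inE negbK => /eqP.
  split=> //; apply/asboolP; split; first by exists w.
  move=> u [uw uS]; apply: (Frontier_face ww) => // j wj.
  by apply: uS; rewrite // inE negbK wj.
have domK x : P x -> exists S, good S /\ exists2 w, K S w & f x <= f (w *m V).
  move=> Px; have [y yF xy] := Frontier_dominates Px.
  have := yF.1; rewrite conv_rows => -[w ww wy].
  have wF : Frontier P (w *m V) by rewrite wy.
  exists [set j | w 0 j != 0]%SET; have [Kw gS] := supp w ww wF; split=> //.
  by exists w => //; rewrite wy; apply: fM xy => //; exact: yF.1.
(* [m S] is a maximizer on a good face; 0 is a dummy value for the other sets. *)
have /choice[m mP] S : exists w,
    good S -> K S w /\ forall u, K S u -> f (u *m V) <= f (w *m V).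
  have [gS|gS] := boolP (good S); last by exists 0.
  by have [w Kw wmax] := maxK S gS; exists w.
have [S0 [gS0 _]] := domK _ (conv_mul ww0).
have [S gS Smax] := @arg_maxP _ _ _ S0 good (fun S => f (m S *m V)) gS0.
have [KmS mSmax] := mP S gS.
exists (m S); first exact: KmS.1.
split; first by have /asboolP[_] := gS; exact.
split; first exact: conv_mul KmS.1.
move=> x /domK[T [gT [w Kw fx]]].
by apply: le_trans fx _; apply: le_trans ((mP T gT).2 w Kw) (Smax T gT).
Unshelve. all: by end_near.
Qed.

End Polytope.

(** * Integer rounding and finite sets *)

(* Differences of the rounded-down partial sums of the weights. *)
Lemma exists_rounding {R : realType} k (l : nat) (w : 'rV[R]_k) :
  weights k l%:R w ->
  exists c : 'I_k -> nat, (\sum_j c j)%N = l /\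
    forall j, `|(c j)%:R - w 0 j| <= 1 /\ (w 0 j = 0 -> c j = 0%N).
Proof.
move=> [w0 wl].
pose A m := \sum_(i < k | (i < m)%N) w 0 i.
have A_ge0 m : 0 <= A m by exact: sumr_ge0.
have AS (j : 'I_k) : A j.+1 = A j + w 0 j.
  rewrite /A (bigD1 j) //= addrC; congr (_ + _); apply: eq_bigl => i.
  by rewrite ltnS ltn_neqAle andbC.
have Ale m p : (m <= p)%N -> A m <= A p.
  move=> mp; rewrite /A [leRHS](bigID (fun i : 'I_k => (i < m)%N)) /=.
  rewrite ler_wpDr ?sumr_ge0 // le_eqVlt; apply/orP; left; apply/eqP.
  apply: eq_bigl => i; case: (ltnP i m) => im; last by rewrite andbF.
  by rewrite (leq_trans im mp).
pose t m := Num.truncn (A m).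
exists (fun j : 'I_k => (t j.+1 - t j)%N); split.
  rewrite -(big_mkord xpredT (fun j => t j.+1 - t j)%N) telescope_sumn; last first.
    by move=> m p mp; apply: le_truncn; exact: Ale.
  have -> : t 0%N = 0%N by rewrite /t /A big_pred0 ?truncn0.
  (* The full sum is the integer [l], so rounding it down loses nothing. *)
  rewrite subn0 /t; have -> : A k = l%:R
    by rewrite -wl; apply: eq_bigl => i; rewrite ltn_ord.
  exact: natrK.
move=> j; split; last by move=> wj; rewrite /t AS wj addr0 subnn.
rewrite natrB; last by apply: le_truncn; exact: Ale.
have /andP[] := truncn_itv (A_ge0 j); have /andP[] := truncn_itv (A_ge0 j.+1).
rewrite -/(t _) -/(t _) AS -!natr1 ler_norml => *; apply/andP; split; lra.
Qed.

(** Distinct rows are requested so that counting row indices amounts to counting points of [E]. *)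
Lemma finite_set_rows {R : realType} n (E : set 'rV[R]_n) : finite_set E ->
  exists k (V : 'M[R]_(k, n)), injective (fun j => row j V) /\ E = rows V.
Proof.
move=> Efin; pose s := fset_set E.
exists (size s), (\matrix_j nth 0 s j); split=> [i j|].
  by rewrite !rowK => /eqP; rewrite nth_uniq ?fset_uniq // => /eqP/val_inj.
have sE x : (x \in (s : seq _)) = (x \in E) by rewrite in_fset_set.
apply/seteqP; split=> x.
  move=> /mem_set; rewrite -sE => xs.
  have lt_x : (index x s < size s)%N by rewrite index_mem.
  by exists (Ordinal lt_x) => //; rewrite rowK nth_index.
by move=> [j _ <-]; rewrite rowK; apply/set_mem; rewrite -sE mem_nth.
Qed.

Lemma finite_argmax {T : choiceType} {R : realType} (A : set T) (g : T -> R) :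
  finite_set A -> A !=set0 -> argmax A g !=set0.
Proof.
move=> Afin [a0 /mem_set]; rewrite -(in_fset_set Afin) => Aa0.
have [x _ xmax] := @arg_maxP _ _ _ [` Aa0]%fset xpredT (fun x => g (val x)) isT.
exists (val x); split; first by have := valP x; rewrite in_fset_set // => /set_mem.
move=> b /mem_set; rewrite -(in_fset_set Afin) => Ab.
exact: (xmax [` Ab]%fset).
Qed.

(** A point of largest coordinate sum cannot be dominated. *)
Lemma Frontier_nonempty {R : realType} n (E : set 'rV[R]_n) :
  finite_set E -> E !=set0 -> Frontier E !=set0.
Proof.
move=> Efin E0.
have [x [Ex xmax]] := finite_argmax (fun x : 'rV[R]_n => \sum_i x 0 i) Efin E0.
exists x; split=> // -[y /xmax + [xy [i xyi]]]; apply/negP; rewrite -ltNge.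
rewrite (bigD1 i) //= [ltRHS](bigD1 i) //=.
by apply: ltr_leD => //; exact: ler_sum.
Qed.

(** * Analysis of the greedy run *)

Section Algorithm.
Context {R : realType} {k n : nat}.
Variables (V : 'M[R]_(k, n)) (f : 'rV[R]_n -> R) (l : nat).
Hypothesis l_gt0 : (0 < l)%N.
Let P := conv (rows V).
Let lV_ge0 : 0 <= l%:R^-1 :> R. Proof. by rewrite invr_ge0. Qed.
Let lR_neq0 : l%:R != 0 :> R. Proof. by rewrite pnatr_eq0 -lt0n. Qed.


(** A step adds mass [1 / l] to a single row. *)
Lemma steps_weights t u e : weights k (t%:R / l%:R) u -> steps (rows V) l e ->
  exists2 u', weights k (t.+1%:R / l%:R) u' & u *m V + e = u' *m V.
Proof.
move=> uw [x [[j _ <-] _] <-].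
exists (u + l%:R^-1 *: delta_mx 0 j); last by rewrite mulmxDl -scalemxAl -rowE.
rewrite -natr1 mulrDl mul1r; apply: weightsD => //.
by rewrite -[X in weights _ X]mulr1; apply: weightsZ => //; exact: weights_delta.
Qed.

Lemma LDGM_run_weights xs t : LDGM_run (rows V) f l xs -> (t <= l)%N ->
  exists2 u, weights k (t%:R / l%:R) u & xs t = u *m V.
Proof.
move=> [xs0 xsS]; elim: t => [_|t IHt tl].
  by exists 0; [rewrite mul0r; exact: weights0|rewrite xs0 mul0mx].
have [u uw xsu] := IHt (ltnW tl).
have [e [es _] ->] := xsS t tl.
by have [u' uw' E] := steps_weights uw es; exists u' => //; rewrite xsu.
Qed.

Lemma LDGM_run_conv xs : LDGM_run (rows V) f l xs -> P (xs l).
Proof.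
move=> /LDGM_run_weights/(_ (leqnn l)) [u uw ->].
by apply: conv_mul; rewrite divff in uw.
Qed.

(** Placing the missing mass [1 - c] on any row only increases the coordinates, since the rows are
    nonnegative. *)
Lemma subconvex_dominated c u : rows V !=set0 -> (forall p, P p -> vle 0 p) ->
  c <= 1 -> weights k c u -> vle 0 (u *m V) /\ exists2 p, P p & vle (u *m V) p.
Proof.
move=> [_ [j0 _ _]] P0 c1 uw.
have V0 j i : 0 <= row j V 0 i by have := P0 _ (conv_row V j) i; rewrite mxE.
split=> [i|].
  by rewrite mul_rowE summxE mxE sumr_ge0 // => j _; rewrite mxE mulr_ge0 ?uw.1.
exists ((u + (1 - c) *: delta_mx 0 j0) *m V).
  have c1' : 0 <= 1 - c by rewrite subr_ge0.
  have := weightsD uw (weightsZ c1' (weights_delta j0)).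
  by rewrite mulr1 addrC subrK; exact: conv_mul.
move=> i; rewrite mulmxDl -scalemxAl -rowE [leRHS]mxE lerDl mxE.
by rewrite mulr_ge0 ?subr_ge0.
Qed.

(* The target [y] may leave the domain when added to [x], so the increment is
   the positive part of [y - x]: then [x + d] is the join of [x] and [y]. *)
Lemma greedy_step X t u (y : 'rV[R]_n) (es : seq 'rV[R]_n) (M : R) :
  rows V !=set0 -> (forall p, P p -> vle 0 p) -> monotone_on X f ->
  (forall z, vle 0 z -> (forall i, exists2 p, P p & z 0 i <= p 0 i) -> X z) ->
  (t < l)%N -> weights k (t%:R / l%:R) u ->
  P y -> y = \sum_(e <- es) e -> size es = l ->
  (forall e, e \in es -> steps (rows V) l e) ->
  (forall e, steps (rows V) l e -> f (u *m V + e) - f (u *m V) <= M) ->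
  dr_ratio X f * (f y - f (u *m V)) <= l%:R * M.
Proof.
move=> V0 P0 fM XP tl uw Py yE sz esS eM.
have tl1 m : (m <= l)%N -> m%:R / l%:R <= 1 :> R.
  by move=> ml; rewrite ler_pdivrMr ?ltr0n // mul1r ler_nat.
have [x0 [p Pp xp]] := subconvex_dominated V0 P0 (tl1 _ (ltnW tl)) uw.
set x := u *m V in x0 xp eM *.
have x0i i : 0 <= x 0 i by have := x0 i; rewrite mxE.
have y0i i : 0 <= y 0 i by have := P0 _ Py i; rewrite mxE.
pose d : 'rV[R]_n := \row_i Num.max (y 0 i - x 0 i) 0.
have xdE i : (x + d) 0 i = Num.max (y 0 i) (x 0 i).
  by rewrite mxE [d 0 i]mxE addr_maxr addr0 addrC subrK.
have d0 : vle 0 d by move=> i; rewrite !mxE le_max lexx orbT.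
(* A point below the join of [x] and [y] need not lie below a single point of the polytope; each
   coordinate gets its own witness, [y] or [p]. *)
have Xxd z : vle 0 z -> vle z (x + d) -> X z.
  move=> z0 zxd; apply: XP => // i; have := zxd i; rewrite xdE le_max => /orP[zy|zx].
    by exists y.
  by exists p => //; apply: le_trans zx (xp i).
have dy : vle d (\sum_(e <- es) e).
  by rewrite -yE => i; rewrite mxE ge_max y0i andbT lerBlDr lerDl.
have esP e : e \in es -> [/\ vle 0 e, X (x + e) & f (x + e) - f x <= M].
  move=> /esS es_e; split; last exact: eM.
    case: es_e => v [[j _ <-] _] <- i; rewrite !mxE mulr_ge0 //.
    by have := P0 _ (conv_row V j) i; rewrite !mxE.
  have [u' uw' xe] := steps_weights uw es_e; rewrite xe.
  have [xe0 [q Pq xq]] := subconvex_dominated V0 P0 (tl1 _ tl) uw'.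
  by apply: XP => // i; exists q.
have := dr_ratio_cover fM Xxd x0 d0 dy esP; rewrite sz; apply: le_trans.
(* It remains to compare [f y] with [f (x + d)], as the join lies above [y]. *)
rewrite ler_wpM2l ?dr_ratio_ge0 // lerD2r; apply: fM.
- by apply: XP => [|i]; [exact: P0|exists y].
- by apply: Xxd; [exact: vle_trans x0 (vle_addr _ d0)|exact: vle_refl].
- by move=> i; rewrite xdE le_max lexx.
Qed.

Lemma LDGM_bound X xs y (es : seq 'rV[R]_n) :
  rows V !=set0 -> (forall p, P p -> vle 0 p) -> monotone_on X f -> f 0 = 0 ->
  (forall z, vle 0 z -> (forall i, exists2 p, P p & z 0 i <= p 0 i) -> X z) ->
  P y -> y = \sum_(e <- es) e -> size es = l ->
  (forall e, e \in es -> steps (rows V) l e) ->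
  LDGM_run (rows V) f l xs ->
  (1 - expR (- dr_ratio X f)) * f y <= f (xs l).
Proof.
move=> V0 P0 fM f0 XP Py yE sz esS run.
set b := dr_ratio X f.
have b0 : 0 <= b by exact: dr_ratio_ge0.
have lR1 : 1 <= l%:R :> R by rewrite ler1n.
(* Since [b <= 1 <= l], the contraction factor is nonnegative, which allows multiplying the
   induction hypothesis by it. *)
have bl1 : 0 <= 1 - b / l%:R.
  rewrite subr_ge0 ler_pdivrMr ?ltr0n // mul1r.
  exact: le_trans (dr_ratio_le1 fM) lR1.
have fy0 : 0 <= f y.
  rewrite -f0; apply: fM; last exact: P0.
    by apply: XP => [|i]; [exact: vle_refl|exists y => //; exact: P0].
  by apply: XP => [|i]; [exact: P0|exists y].
have gap t : (t <= l)%N -> f y - f (xs t) <= (1 - b / l%:R) ^+ t * f y.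
  elim: t => [_|t IHt tl]; first by rewrite expr0 mul1r run.1 f0 subr0.
  have [u uw xsu] := LDGM_run_weights run (ltnW tl).
  have [e [es_e emax] xsS] := run.2 t tl.
  have H := greedy_step (M := f (xs t.+1) - f (xs t)) V0 P0 fM XP tl uw Py yE sz esS.
  have {}H : b * (f y - f (xs t)) <= l%:R * (f (xs t.+1) - f (xs t)).
    by rewrite {1}xsu; apply: H => e' /emax; rewrite -xsu -xsS.
  have {H}Hb : b / l%:R * (f y - f (xs t)) <= f (xs t.+1) - f (xs t).
    by rewrite mulrAC ler_pdivrMr ?ltr0n // [leRHS]mulrC.
  rewrite exprS -mulrA; apply: le_trans (ler_wpM2l bl1 (IHt (ltnW tl))).
  lra.
(* From [1 - b / l <= expR (- (b / l))], raised to the power [l]. *)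
have pow_le : (1 - b / l%:R) ^+ l <= expR (- b).
  have -> : - b = - (b / l%:R) * l%:R by rewrite mulNr divfK.
  rewrite expRM_natr; apply: lerXn2r; rewrite ?nnegrE ?expR_ge0 //.
  exact: expR_ge1Dx.
have := gap l (leqnn l); have := ler_wpM2r fy0 pow_le; lra.
Qed.

End Algorithm.

(** * Existence of an output and size of the step set *)

Lemma LDGM_output_nonempty {R : realType} n (E : set 'rV[R]_n) f l :
  finite_set E -> E !=set0 -> LDGM_output E f l !=set0.
Proof.
move=> Efin E0.
have Sfin : finite_set (steps E l).
  by apply: finite_image; apply: sub_finite_set Efin => x [].
have S0 : steps E l !=set0.
  by have [x Fx] := Frontier_nonempty Efin E0; exists (l%:R^-1 *: x); exists x.
have /choice[g gP] x : exists e, argmax (steps E l) (fun e' => f (x + e') - f x) e.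
  exact: finite_argmax.
pose xs t := iter t (fun x => x + g x) 0.
exists (xs l), xs => //; split=> // t _.
by exists (g (xs t)).
Qed.

Lemma card_steps {R : realType} n (E : set 'rV[R]_n) l : (0 < l)%N -> finite_set E ->
  #|` fset_set (steps E l)|%fset = #|` fset_set (Frontier E)|%fset.
Proof.
move=> l0 Efin.
rewrite fset_set_image; last by apply: sub_finite_set Efin => x [].
by rewrite card_imfset //; apply: scalerI; rewrite invr_eq0 pnatr_eq0 -lt0n.
Qed.

Lemma card_Frontier {R : realType} n (E : set 'rV[R]_n) : finite_set E ->
  (#|` fset_set (Frontier E)|%fset <= #|` fset_set E|%fset)%N.
Proof.
move=> Efin; apply: fsubset_leq_card.
have FE : Frontier E `<=` E by move=> x [].
by rewrite -fset_set_sub // ; exact: sub_finite_set Efin.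
Qed.

(** * Rounding an optimal frontier point to [l] steps *)

Section Rounding.
Context {R : realType} {k n : nat}.
Variable V : 'M[R]_(k, n).
Let P := conv (rows V).

(** A row with positive weight lies on the face of [w *m V], so [Frontier_face] puts it on the
    frontier of the polytope, and a fortiori on that of the rows. *)
Lemma Frontier_support w j : weights k 1 w -> Frontier P (w *m V) -> w 0 j != 0 ->
  Frontier (rows V) (row j V).
Proof.
move=> ww wF wj; split; first by exists j.
have [_ jF] : Frontier P (row j V).
  rewrite rowE; apply: Frontier_face (weights_delta j) _ wF => // i wi.
  by rewrite mxE /=; case: eqP => // ij; rewrite -ij wi eqxx in wj.
by move=> [y [i _ <-] yj]; apply: jF; exists (row i V) => //; exact: conv_row.
Qed.

Lemma card_support (w : 'rV[R]_k) : injective (fun j => row j V) ->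
  weights k 1 w -> Frontier P (w *m V) ->
  (#|[pred j | w ord0 j != 0%R]| <= #|` fset_set (Frontier (rows V))|%fset)%N.
Proof.
move=> Vinj ww wF.
have Ffin : finite_set (Frontier (rows V)).
  apply: (@sub_finite_set _ _ (rows V)) => [x []//|].
  by apply: finite_image; exact: finite_finset.
rewrite cardE -(size_map (fun j => row j V)).
apply: uniq_leq_size; first by rewrite map_inj_uniq ?enum_uniq.
move=> x /mapP[j]; rewrite mem_enum => wj ->.
by rewrite in_fset_set //; apply: mem_set; exact: Frontier_support wj.
Qed.

(** The weights of [y] are [c j / l] with integers [c j] summing to [l]. At most [m] weights are
    nonzero and each moves by at most [1 / l], whence the loss [m D L / l]. *)
Lemma exists_rounded_target (f : 'rV[R]_n -> R) (L D : R) l w : (0 < l)%N ->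
  injective (fun j => row j V) -> 0 <= L ->
  (forall x y, Frontier P x -> Frontier P y -> `|f x - f y| <= L * enorm (x - y)) ->
  (forall x, P x -> enorm x <= D) ->
  weights k 1 w -> Frontier P (w *m V) ->
  exists y es, [/\ P y, y = \sum_(e <- es) e, size es = l,
    forall e, e \in es -> steps (rows V) l e &
    f (w *m V) - #|` fset_set (Frontier (rows V))|%fset%:R * D * L / l%:R <= f y].
Proof.
move=> l0 Vinj L0 fL VD ww wF.
have lV0 : 0 <= l%:R^-1 :> R by rewrite invr_ge0.
have lR0 : l%:R != 0 :> R by rewrite pnatr_eq0 -lt0n.
have [c [cl cP]] : exists c : 'I_k -> nat, (\sum_j c j)%N = l /\
    forall j, `|(c j)%:R - (l%:R *: w) 0 j| <= 1 /\ ((l%:R *: w) 0 j = 0 -> c j = 0%N).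
  by apply: exists_rounding; rewrite -[X in weights _ X]mulr1; exact: weightsZ.
pose v : 'rV[R]_k := \row_j ((c j)%:R / l%:R).
have vw : weights k 1 v.
  split=> [j|]; first by rewrite mxE mulr_ge0.
  under eq_bigr do rewrite mxE.
  by rewrite -mulr_suml -natr_sum cl divff.
have vs j : w 0 j = 0 -> v 0 j = 0.
  by move=> wj; rewrite mxE (cP j).2 ?mul0r // mxE wj mulr0.
have vF : Frontier P (v *m V) by exact: Frontier_face ww vw vs wF.
(* Row [j], scaled by [1 / l], is repeated [c j] times; only rows in the support of [w] occur, so
   all entries are valid steps. *)
pose es := flatten [seq nseq (c j) (l%:R^-1 *: row j V) | j : 'I_k].
exists (v *m V), es; split.
- exact: vF.1.
- rewrite /es big_flatten big_map /= mul_rowE big_enum /=.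
  apply: eq_bigr => j _; rewrite big_nseq mxE.
  by rewrite iter_addr_0 -[RHS]scaler_nat scalerA.
- rewrite size_flatten /shape -map_comp sumnE big_map big_enum /= -[RHS]cl.
  by apply: eq_bigr => j _; rewrite size_nseq.
- move=> e /flattenP[s /mapP[j _ ->]]; rewrite mem_nseq => /andP[cj /eqP ->].
  exists (row j V) => //; apply: (Frontier_support ww wF).
  by apply: contraTneq cj => wj; rewrite (cP j).2 // mxE wj mulr0.
have D0 : 0 <= D by apply: le_trans (VD _ wF.1); exact: enorm_ge0.
have := lipschitz_weights L0 fL VD wF vF.
have wv : \sum_j `|w 0 j - v 0 j| <= #|` fset_set (Frontier (rows V))|%fset%:R / l%:R.
  have -> : \sum_j `|w 0 j - v 0 j| = \sum_(j | w 0 j != 0) `|w 0 j - v 0 j|.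
    rewrite [RHS]big_mkcond; apply: eq_bigr => j _.
    by case: eqVneq => // wj; rewrite vs // wj subrr normr0.
  apply: (@le_trans _ _ (\sum_(j | w 0 j != 0) l%:R^-1)).
    apply: ler_sum => j _; have [cj _] := cP j.
    have -> : w 0 j - v 0 j = - (l%:R^-1 * ((c j)%:R - (l%:R *: w) 0 j)).
      by rewrite !mxE; field.
    by rewrite normrN normrM (ger0_norm lV0) -[leRHS]mulr1 ler_wpM2l.
  rewrite sumr_const -[leLHS]mulr_natl; apply: ler_wpM2r => //.
  by rewrite ler_nat; exact: card_support.
have := ler_wpM2l (mulr_ge0 L0 D0) wv.
set m := (#|` _|%fset%:R : R).
have -> : L * D * (m / l%:R) = m * D * L / l%:R by field.
have := ler_norm (f (w *m V) - f (v *m V)); lra.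
Qed.

End Rounding.

(** * The approximation guarantee *)

Theorem theorem1 (R : realType) (n : nat) (Xi : 'I_n -> set R)
  (f : 'rV[R]_n -> R) (E : set 'rV[R]_n) (L D : R) :
  let X := prodset Xi in
  let P := conv E in
  let beta := dr_ratio X f in
  (forall i, compact (Xi i)) ->
  (forall i, Xi i `<=` [set t | 0 <= t]) ->
  finite_set E ->
  E !=set0 ->
  (forall p, P p -> vle 0 p) ->
  (forall p z, P p -> vle 0 z -> vle z p -> X z) ->
  monotone_on X f ->
  f 0 = 0 ->
  0 <= L ->
  (forall x y, Frontier P x -> Frontier P y ->
     `|f x - f y| <= L * enorm (x - y)) ->
  (forall x, P x -> enorm x <= D) ->
  exists2 OPT : R, (exists2 z, argmax P f z & OPT = f z) &
  forall l : nat, (0 < l)%N ->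
    let m := #|` fset_set (steps E l)|%fset in
    [/\ LDGM_output E f l !=set0,
        forall x, LDGM_output E f l x ->
          P x /\
          (1 - expR (- beta)) * OPT
            - (1 - expR (- beta)) * m%:R * D * L / l%:R <= f x,
        m = #|` fset_set (Frontier E)|%fset
      & (m <= #|` fset_set E|%fset)%N].
Proof.
move=> X P beta _ _ Efin E0 P0 XP fM f0 L0 fL PD.
(* As [X] is a product, membership is checked coordinate by coordinate: the vector keeping only
   coordinate [i] of [z] lies below [p], hence in [X]. *)
have XPi z : vle 0 z -> (forall i, exists2 p, P p & z 0 i <= p 0 i) -> X z.
  move=> z0 zP i; have [p Pp zp] := zP i.
  have z0i j : 0 <= z 0 j by have := z0 j; rewrite mxE.
  have := XP p (z 0 i *: chi i) Pp (chi_ge0 _ (z0i i)) _ i.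
  rewrite /chi !mxE !eqxx mulr1; apply=> j; rewrite !mxE /=.
  case: eqP => [->|_]; first by rewrite mulr1.
  by rewrite mulr0; have := P0 p Pp j; rewrite mxE.
have [k [V [Vinj EV]]] := finite_set_rows Efin.
have [w0 ww0] : exists w0 : 'rV[R]_k, weights k 1 w0.
  by case: E0; rewrite EV => _ [j _ _]; exists (delta_mx 0 j); exact: weights_delta.
have XPP p : P p -> X p by move=> Pp; apply: XPi => [|i]; [exact: P0|exists p].
subst E.
have [w ww [wF wmax]] := exists_argmax_conv L0 fL PD ww0
  (fun x y Px Py => fM x y (XPP _ Px) (XPP _ Py)).
exists (f (w *m V)); first by exists (w *m V).
move=> l l0 m; have mE : m = #|` fset_set (Frontier (rows V))|%fset by exact: card_steps.
split=> //; first exact: LDGM_output_nonempty; last by rewrite mE; exact: card_Frontier.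
move=> _ [xs run ->]; split; first exact: LDGM_run_conv run.
have [y [es [Py yE sz esS fy]]] := exists_rounded_target l0 Vinj L0 fL PD ww wF.
have := LDGM_bound l0 E0 P0 fM f0 XPi Py yE sz esS run; apply: le_trans.
have b0 : 0 <= 1 - expR (- beta).
  by rewrite subr_ge0 -expR0 ler_expR oppr_le0; exact: dr_ratio_ge0.
(* The rounding loss is incurred before the greedy bound, so it too carries the factor
   [1 - expR (- beta)]. *)
rewrite -/beta; apply: le_trans (ler_wpM2l b0 fy).
by rewrite mE mulrBr !mulrA.
Qed.
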